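(* There are constants $c>0$ and $d>0$ such that for all sufficiently large $n$, every $2^{2^{n/2}}$-bounded PCR/$\mathbb{Q}$ refutation of $Q_n$ that uses at most $2^{dn}$ distinct monomials has height at least $$2^{n/2-2}-\frac{cn+2\log n}{2^{n/2+2}}-1.$$
   Context: For $i\in[n]$, $j\in[2n]$ there are twin pairs $x_{ij},\bar x_{ij}$; $\mathrm{ks}_i=\sum_{j\in[2n]}x_{ij}-n$. $Q_n$ consists of: $\mathrm{ks}_1-1/2=0$; $\mathrm{ks}_i^2-\mathrm{ks}_{i+1}=0$ for $i\in[n-1]$; $\mathrm{ks}_n^2=0$. A PCR/$\mathbb{Q}$ proof from $Q$ is a sequence $p_1,\dots,p_\ell$ where each $p_i$ is in $Q$, a logical axiom $x^2-x$ or $x+\bar x-1$ for a twin pair, a product $xp_j$ ($j<i$, $x$ a variable), or $ap_j+bp_k$ ($j,k<i$, $a,b\in\mathbb{Q}$); a refutation ends with $1$. The height is the length of the longest path from a leaf to the last line in the proof DAG. It is $R$-bounded if all coefficients of all lines and all scalars $a,b$ have absolute value at most $R$. $\log$ is base 2. *)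

(* Defs.v *)
From Stdlib Require Import Reals ZArith.
From HB Require Import structures.
From mathcomp Require Import all_boot all_order all_algebra.
From mathcomp Require Import mpoly.
Set Implicit Arguments. Unset Strict Implicit. Unset Printing Implicit Defensive.
Import Order.TTheory GRing.Theory Num.Theory.

Local Open Scope ring_scope.

Definition var_t (n : nat) : finType := ('I_n * 'I_(2 * n) * bool)%type.
Definition nvars (n : nat) : nat := #|{: var_t n}|.
Definition poly (n : nat) := {mpoly rat[nvars n]}.

Definition X (n : nat) (v : var_t n) : poly n := 'X_(enum_rank v).
Definition x (n : nat) (i : 'I_n) (j : 'I_(2 * n)) : poly n := X (i, j, false).
Definition xbar (n : nat) (i : 'I_n) (j : 'I_(2 * n)) : poly n := X (i, j, true).

Definition ks (n : nat) (i : 'I_n) : poly n :=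
  \sum_(j < 2 * n) x i j - (n%:R)%:MP.

(** Membership in Q_n (index i of the paper is val i + 1). *)
Definition inQ (n : nat) (p : poly n) : Prop :=
  (exists i : 'I_n, val i = 0%N /\ p = ks i - (1 / 2 : rat)%:MP)
  \/ (exists i i' : 'I_n, val i' = (val i).+1 /\ p = ks i ^+ 2 - ks i')
  \/ (exists i : 'I_n, val i = n.-1 /\ p = ks i ^+ 2).

Inductive rule (n : nat) : Type :=
| RHyp
| RBool of var_t n
| RTwin of 'I_n & 'I_(2 * n)
| RMul of var_t n & nat
| RLin of rat & rat & nat & nat.

Definition line (n : nat) := (poly n * rule n)%type.

Definition valid_line (n : nat) (lines : seq (line n)) (t : nat) : Prop :=
  let p := (nth (0, RHyp n) lines t).1 in
  let P k := (nth (0, RHyp n) lines k).1 in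
  match (nth (0, RHyp n) lines t).2 with
  | RHyp => inQ p
  | RBool v => p = X v ^+ 2 - X v
  | RTwin i j => p = x i j + xbar i j - 1
  | RMul v k => (k < t)%N /\ p = X v * P k
  | RLin a b k l => [/\ (k < t)%N, (l < t)%N & p = a *: P k + b *: P l]
  end.

Definition pcr_refutation (n : nat) (lines : seq (line n)) : Prop :=
  [/\ (0 < size lines)%N,
      (forall t, (t < size lines)%N -> valid_line lines t)
    & (last (0, RHyp n) lines).1 = 1].

(** Height: length of the longest path from a leaf (axiom line) to the
    last line of the proof DAG. *)
Definition next_height (n : nat) (hs : seq nat) (r : rule n) : nat :=
  match r with
  | RMul _ k => (nth 0 hs k).+1
  | RLin _ _ k l => (maxn (nth 0 hs k) (nth 0 hs l)).+1
  | _ => 0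
  end.

Definition heights (n : nat) (lines : seq (line n)) : seq nat :=
  foldl (fun hs (ln : line n) => rcons hs (next_height hs ln.2)) [::] lines.

Definition pcr_height (n : nat) (lines : seq (line n)) : nat :=
  last 0%N (heights lines).

Definition pcr_num_monomials (n : nat) (lines : seq (line n)) : nat :=
  size (undup (flatten [seq msupp ln.1 | ln <- lines])).

Definition int_to_Z (z : int) : Z :=
  match z with
  | Posz k => Z.of_nat k
  | Negz k => Z.opp (Z.of_nat k.+1)
  end.
Definition rat2R (q : rat) : R :=
  Rdiv (IZR (int_to_Z (numq q))) (IZR (int_to_Z (denq q))).

Definition pcr_bounded (n : nat) (Rb : R) (lines : seq (line n)) : Prop :=
  forall t, (t < size lines)%N ->
    let ln := nth (0, RHyp n) lines t in
    (forall m : 'X_{1..nvars n}, Rle (Rabs (rat2R (ln.1@_m))) Rb)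
    /\ (match ln.2 with
        | RLin a b _ _ => Rle (Rabs (rat2R a)) Rb /\ Rle (Rabs (rat2R b)) Rb
        | _ => True
        end).

Definition log2 (y : R) : R := Rdiv (ln y) (ln 2).
Definition pow2 (y : R) : R := Rpower 2 y.

Definition height_bound (c : R) (n : nat) : R :=
  Rminus (Rminus (pow2 (Rminus (Rdiv (INR n) 2) 2))
                 (Rdiv (Rplus (Rmult c (INR n)) (Rmult 2 (log2 (INR n))))
                       (pow2 (Rplus (Rdiv (INR n) 2) 2))))
         1.

(* Main.v *)
Require Import Defs.
From Stdlib Require Import Reals Lra.
From mathcomp Require Import all_boot all_order all_fingroup all_algebra.
From mathcomp Require Import ring lra zify mpoly.
Set Implicit Arguments. Unset Strict Implicit. Unset Printing Implicit Defensive.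
Import Order.TTheory GRing.Theory Num.Theory.

(** Write [ks_i = |s_i| - n], where [|s_i|] is the sum of block [i] of an assignment
[s], and let [r_i = 2^(-2^i)] (counting blocks from 0) be the value that the
equations force on [ks_i]. The signed measure with weight
[prod_i (-1)^|s_i| / (n + r_i - |s_i|)] satisfies every equation
[ks_i = r_i] against functions that ignore a variable of block [i]: multiplying by
[n + r_i - |s_i|] cancels the denominator and leaves an alternating sum. So it
respects all hypotheses except [ks_n^2 = 0], where its error is [2^(-2^n)] times the
total mass.

Few monomials leave room for a greedy restriction of a small fraction of each block
after which every line has low degree in every block. The size of a line [p] is then
the largest integral of [p * phi_M], where [phi_M] is the product of the differences
[x_a - x_b] over the pairs of a matching [M] inside the blocks. For [|M|] above the
degree this integral vanishes, by antisymmetry. Using [|s_i| = n + r_i],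
[x_c * phi_M] is an average of products [phi_M'] with polynomially bounded
coefficients, so multiplying by a variable costs a polynomial factor and a linear
combination a factor [2 R]. A refutation of height [h] must amplify [2^(-2^n)]
to [1], hence [(2 R)^h >= 2^(2^n)]. *)

(** * The signed measure on assignments and its two cancellations *)

Section Functional.
Local Open Scope ring_scope.

Variables (V I : finType) (bl : V -> I) (K : realFieldType).
Variables (kap : I -> K) (A : {set V}) (F : V -> bool).
Hypothesis kap_notnat : forall i k, kap i != k%:R.

Local Notation asg := {ffun V -> bool}.
Implicit Types (s : asg) (v : V) (i : I) (f g h psi : asg -> K).
Implicit Types (M : seq (V * V)) (S : {set V}).

Definition cnt i s : K := \sum_(v | bl v == i) (s v)%:R.
(** [A] holds the variables left free by the restriction; all others are frozen to [F]. *)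
Definition agrees s := [forall v, (v \in A) || (s v == F v)].
Definition weight s : K :=
  (agrees s)%:R * \prod_v (-1) ^+ s v * \prod_i (kap i - cnt i s)^-1.
Definition wsum h : K := \sum_s weight s * h s.

Lemma eq_wsum h g : (forall s, agrees s -> h s = g s) -> wsum h = wsum g.
Proof.
move=> hg; apply: eq_bigr => s _; rewrite /weight.
by case: (boolP (agrees s)) => [/hg ->|_] //; rewrite !mul0r.
Qed.

Lemma wsum_add h g : wsum (fun s => h s + g s) = wsum h + wsum g.
Proof. by rewrite /wsum -big_split; apply: eq_bigr => s _; rewrite mulrDr. Qed.

Lemma wsum_scale c h : wsum (fun s => c * h s) = c * wsum h.
Proof. by rewrite /wsum mulr_sumr; apply: eq_bigr => s _; rewrite mulrCA. Qed.

Lemma wsum_sum (J : Type) (r : seq J) (P : pred J) (h : J -> asg -> K) :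
  wsum (fun s => \sum_(j <- r | P j) h j s) = \sum_(j <- r | P j) wsum (h j).
Proof.
by rewrite /wsum exchange_big; apply: eq_bigr => s _; rewrite mulr_sumr.
Qed.

Lemma kap_cnt_neq0 i s : kap i - cnt i s != 0.
Proof. by rewrite subr_eq0 /cnt -natr_sum. Qed.

Lemma sum_antisym (J : finType) (t : J -> J) (h : J -> K) :
  injective t -> (forall j, h (t j) = - h j) -> \sum_j h j = 0.
Proof.
move=> t_inj ht.
have: \sum_j h j = - \sum_j h j.
  by rewrite {1}(reindex_inj t_inj) -sumrN; apply: eq_bigr.
by move=> ?; lra.
Qed.

Definition toggle (a : V) s : asg := [ffun v => (v == a) (+) s v].
Definition swap (a b : V) s : asg := [ffun v => s (tperm a b v)].

Lemma toggleK a : involutive (toggle a).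
Proof. by move=> s; apply/ffunP => v; rewrite !ffunE addbA addbb. Qed.

Lemma swapK a b : involutive (swap a b).
Proof. by move=> s; apply/ffunP => v; rewrite !ffunE tpermK. Qed.

Lemma agrees_toggle a s : a \in A -> agrees (toggle a s) = agrees s.
Proof.
move=> aA; apply: eq_forallb => v; rewrite ffunE.
by case: (eqVneq v a) => [->|_] //=; rewrite aA.
Qed.

Lemma cnt_toggle a s i : bl a != i -> cnt i (toggle a s) = cnt i s.
Proof.
move=> ai; apply: eq_bigr => v /eqP vi; rewrite ffunE.
by case: eqVneq => [va|] //; rewrite -va vi eqxx in ai.
Qed.

Lemma sign_toggle a s :
  \prod_v (-1) ^+ toggle a s v = - \prod_v (-1) ^+ s v :> K.
Proof.
rewrite (bigD1 a) // [in RHS](bigD1 a) //= ffunE eqxx -mulNr.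
congr (_ * _); first by case: (s a); rewrite ?expr1 ?expr0 ?opprK.
by apply: eq_bigr => v va; rewrite ffunE (negbTE va).
Qed.

(** The factor cancels the only denominator that sees [a]; flipping [a] then changes nothing but the
    sign of each term. *)
Lemma wsum_toggle a h : a \in A -> (forall s, h (toggle a s) = h s) ->
  wsum (fun s => (kap (bl a) - cnt (bl a) s) * h s) = 0.
Proof.
move=> aA ha.
pose g s := (agrees s)%:R * \prod_v (-1) ^+ s v *
  \prod_(i | i != bl a) (kap i - cnt i s)^-1 * h s.
rewrite /wsum (eq_bigr g) => [|s _].
  apply: (sum_antisym (inv_inj (@toggleK a))) => s.
  rewrite /g agrees_toggle // sign_toggle ha.
  rewrite (eq_bigr (fun i => (kap i - cnt i s)^-1)) => [|i ia]; first by ring.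
  by rewrite cnt_toggle // eq_sym.
rewrite /g /weight (bigD1 (bl a)) //=.
by have := kap_cnt_neq0 (bl a) s; move: (kap _ - _) => y y0; field.
Qed.

(** The weight is symmetric in two free variables of one block, since block sums and the total sign
    are. *)
Lemma wsum_swap a b h : a \in A -> b \in A -> bl a = bl b ->
  (forall s, h (swap a b s) = - h s) -> wsum h = 0.
Proof.
move=> aA bA ab hs; apply: (sum_antisym (inv_inj (@swapK a b))) => s.
rewrite hs mulrN; congr (- (_ * _)); rewrite /weight; congr ((nat_of_bool _)%:R * _ * _).
- apply/forallP/forallP => sF v; have := sF v; rewrite ffunE;
    by case: tpermP => // ->; rewrite ?aA ?bA.
- rewrite [RHS](reindex_inj (@perm_inj _ (tperm a b))) /=.
  by apply: eq_bigr => v _; rewrite ffunE.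
apply: eq_bigr => i _; congr (_ - _)^-1; rewrite /cnt.
rewrite [RHS](reindex_inj (@perm_inj _ (tperm a b))) /=.
apply: eq_big => [v|v _]; last by rewrite ffunE.
by case: tpermP => // ->; rewrite ab.
Qed.

(** * Matchings, pair products and low degree per block *)

Definition ends M : seq V := flatten [seq [:: ab.1; ab.2] | ab <- M].
Definition matching M :=
  uniq (ends M) && all (fun ab => [&& ab.1 \in A, ab.2 \in A & bl ab.1 == bl ab.2]) M.
Definition pair_prod M s : K := \prod_(ab <- M) ((s ab.1)%:R - (s ab.2)%:R).
Definition pairs_in i M := count (fun ab => bl ab.1 == i) M.

Definition junta S psi :=
  forall s s', {in S, s =1 s'} -> psi s = psi s'.
Definition in_block i S := [set v in S | bl v == i].

(* The two consequences of having degree at most [D] in every block that the argument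
   uses; both are linear in [f]. *)
Definition low_degree (D : nat) f :=
  (forall i S psi, junta S psi -> (#|in_block i S| + D < #|in_block i A|)%N ->
     wsum (fun s => (kap i - cnt i s) * (psi s * f s)) = 0)
  /\ (forall M i, matching M -> (D < pairs_in i M)%N ->
     wsum (fun s => pair_prod M s * f s) = 0).

Lemma low_degree_ext D f g :
  (forall s, agrees s -> f s = g s) -> low_degree D f -> low_degree D g.
Proof.
move=> fg [f1 f2]; split=> [i S psi Sp lt|M i mM lt].
  by rewrite -(f1 i S psi Sp lt); apply: eq_wsum => s /fg ->.
by rewrite -(f2 M i mM lt); apply: eq_wsum => s /fg ->.
Qed.

Lemma low_degree0 D : low_degree D (fun=> 0).
Proof.
by split=> *; rewrite /wsum big1 // => s _; rewrite !mulr0.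
Qed.

Lemma low_degree_add D f g :
  low_degree D f -> low_degree D g -> low_degree D (fun s => f s + g s).
Proof.
move=> [f1 f2] [g1 g2]; split=> [i S psi Sp lt|M i mM lt].
  rewrite -[RHS]addr0 -[X in _ = X + _](f1 i S psi Sp lt).
  rewrite -[X in _ = _ + X](g1 i S psi Sp lt) -wsum_add.
  by apply: eq_wsum => s _; ring.
rewrite -[RHS]addr0 -[X in _ = X + _](f2 M i mM lt).
by rewrite -[X in _ = _ + X](g2 M i mM lt) -wsum_add; apply: eq_wsum => s _; ring.
Qed.

Lemma low_degree_sum D (J : eqType) (r : seq J) (c : J -> K) (h : J -> asg -> K) :
  (forall j, j \in r -> low_degree D (h j)) ->
  low_degree D (fun s => \sum_(j <- r) c j * h j s).
Proof.
move=> hlow; split=> [i S psi Sp lt|M i mM lt].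
  rewrite (@eq_wsum _ (fun s => \sum_(j <- r) c j *
      ((kap i - cnt i s) * (psi s * h j s)))).
    rewrite wsum_sum big_seq big1 // => j jr; rewrite wsum_scale.
    by rewrite (proj1 (hlow j jr) i S psi Sp lt) mulr0.
  by move=> s _; rewrite !mulr_sumr; apply: eq_bigr => j _; ring.
rewrite (@eq_wsum _ (fun s => \sum_(j <- r) c j * (pair_prod M s * h j s))).
  rewrite wsum_sum big_seq big1 // => j jr; rewrite wsum_scale.
  by rewrite (proj2 (hlow j jr) M i mM lt) mulr0.
by move=> s _; rewrite mulr_sumr; apply: eq_bigr => j _; ring.
Qed.

Lemma endsE M v : (v \in ends M) = has (fun ab => (v == ab.1) || (v == ab.2)) M.
Proof. by elim: M => //= ab M IH; rewrite !inE IH orbA. Qed.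

Lemma ends_perm M M' : perm_eq M M' -> perm_eq (ends M) (ends M').
Proof. by move=> MM'; apply: perm_flatten; apply: perm_map. Qed.

Lemma matching_perm M M' : perm_eq M M' -> matching M = matching M'.
Proof.
by move=> MM'; rewrite /matching (perm_uniq (ends_perm MM')) (perm_all _ MM').
Qed.

Lemma pair_prod_perm M M' s : perm_eq M M' -> pair_prod M s = pair_prod M' s.
Proof. exact: perm_big. Qed.

Lemma matching_cons a b M : matching ((a, b) :: M) =
  [&& a != b, a \notin ends M, b \notin ends M, a \in A, b \in A, bl a == bl b
    & matching M].
Proof.
rewrite /matching /= !inE negb_or.
by do ![case: (_ \in _) | case: (_ == _) | case: uniq | case: all => //=].
Qed.

Lemma pair_prod_cons a b M s :
  pair_prod ((a, b) :: M) s = ((s a)%:R - (s b)%:R) * pair_prod M s.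
Proof. by rewrite /pair_prod big_cons. Qed.

Lemma pair_prod_swap a b M s : matching ((a, b) :: M) ->
  pair_prod ((a, b) :: M) (swap a b s) = - pair_prod ((a, b) :: M) s.
Proof.
rewrite matching_cons => /and4P[_ aM bM _]; rewrite !pair_prod_cons !ffunE tpermL tpermR.
rewrite -mulNr opprB; congr (_ * _); rewrite /pair_prod !big_seq; apply: eq_bigr => cd cdM.
rewrite !ffunE; congr (_%:R - _%:R); congr (s _); apply: tpermD; apply/eqP => e.
- by case/negP: aM; rewrite endsE; apply/hasP; exists cd; rewrite // e eqxx.
- by case/negP: bM; rewrite endsE; apply/hasP; exists cd; rewrite // e eqxx.
- by case/negP: aM; rewrite endsE; apply/hasP; exists cd; rewrite // e eqxx orbT.
- by case/negP: bM; rewrite endsE; apply/hasP; exists cd; rewrite // e eqxx orbT.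
Qed.

Lemma junta_pair_prod M : junta [set v in ends M] (pair_prod M).
Proof.
move=> s s' ss'; rewrite /pair_prod !big_seq; apply: eq_bigr => ab abM.
by rewrite !ss' // inE endsE; apply/hasP; exists ab; rewrite ?eqxx ?orbT.
Qed.

Lemma count_ends M i : matching M ->
  count (fun v => bl v == i) (ends M) = (2 * pairs_in i M)%N.
Proof.
elim: M => [|[a b] M IH] //.
rewrite matching_cons => /and5P[_ _ _ _ /and3P[_ /eqP ab mM]].
by rewrite /pairs_in /= -/(ends M) IH // ab mulnDr; case: eqP.
Qed.

Lemma card_in_block_ends M i : matching M ->
  (#|in_block i [set v in ends M]| <= 2 * pairs_in i M)%N.
Proof.
move=> mM; rewrite -count_ends // -size_filter; apply: leq_trans (card_size _).
by apply: subset_leq_card; apply/subsetP => v; rewrite !inE mem_filter andbC.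
Qed.

Lemma junta_toggle S psi a s : junta S psi -> a \notin S -> psi (toggle a s) = psi s.
Proof.
move=> Sp aS; apply: Sp => v vS; rewrite ffunE.
by case: eqVneq => // va; rewrite -va vS in aS.
Qed.

Lemma junta_swap S psi a b s :
  junta S psi -> a \notin S -> b \notin S -> psi (swap a b s) = psi s.
Proof.
move=> Sp aS bS; apply: Sp => v vS; rewrite ffunE tpermD //.
  by apply: contraNneq aS => ->.
by apply: contraNneq bS => ->.
Qed.

(** The ends are distinct, so each element of [S] meets at most one pair. If the first pair is met,
    the element responsible is deleted from [S] before recursing. *)
Lemma matching_avoid M i S : matching M -> (#|in_block i S| < pairs_in i M)%N ->
  exists ab, [/\ ab \in M, ab.1 \notin S & ab.2 \notin S].
Proof.
elim: M S => [|[a b] M IH] S //.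
rewrite matching_cons => /and5P[_ aM bM _ /and3P[_ /eqP ab mM]].
rewrite /pairs_in /= => lt.
have [/norP[aS bS]|] := boolP (~~ ((a \in S) || (b \in S))).
  by exists (a, b); rewrite mem_head.
rewrite negbK => abS.
have [c [cS cM ci]] : exists c, [/\ c \in S, c \notin ends M & bl c = bl a].
  by case/orP: abS => ?; [exists a | exists b].
have [|cd [cdM c1 c2]] := IH (S :\ c) mM.
  have [bi|bi] := eqVneq (bl a) i.
    move: lt; rewrite bi eqxx add1n ltnS; apply: leq_trans.
    rewrite [X in (_ < X)%N](cardsD1 c) !inE cS ci bi eqxx add1n ltnS.
    by apply: subset_leq_card; apply/subsetP => v; rewrite !inE andbA.
  move: lt; rewrite (negbTE bi); apply: leq_trans; rewrite ltnS.
  by apply: subset_leq_card; apply/subsetP => v; rewrite !inE -andbA => /and3P[_ -> ->].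
exists cd; rewrite inE cdM orbT; split => //.
  apply: contra c1; rewrite !inE => ->; rewrite andbT.
  by apply: contraNneq cM => <-; rewrite endsE; apply/hasP; exists cd; rewrite // eqxx.
apply: contra c2; rewrite !inE => ->; rewrite andbT.
by apply: contraNneq cM => <-; rewrite endsE; apply/hasP; exists cd; rewrite // eqxx orbT.
Qed.

(** For the first clause, a free variable of the block lies outside both juntas and is toggled. For
    the second, some pair of [M] avoids [S], and swapping its ends negates the integrand. *)
Lemma junta_low_degree D S f :
  junta S f -> (forall i, (#|in_block i S| <= D)%N) -> low_degree D f.
Proof.
move=> Sf SD; split=> [i S' psi Sp lt|M i mM lt].
  have /subsetPn[a] : ~~ (in_block i A \subset in_block i S' :|: in_block i S).
    apply/negP => /subset_leq_card le.
    have := leq_trans le (leq_card_setU _ _); rewrite leqNgt => /negP; apply.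
    by apply: leq_ltn_trans lt; rewrite leq_add2l.
  rewrite !inE => /andP[aA /eqP ai]; rewrite ai eqxx !andbT => /norP[aS' aS].
  rewrite -ai; apply: wsum_toggle => // s.
  by rewrite (junta_toggle _ Sp) // (junta_toggle _ Sf).
have [[a b] [abM /= aS bS]] := matching_avoid mM (leq_ltn_trans (SD i) lt).
have pM := perm_to_rem abM; have := mM; rewrite (matching_perm pM) => mM'.
have := mM'; rewrite matching_cons => /and5P[_ _ _ aA /and3P[bA /eqP ab _]].
apply: (@wsum_swap a b) => // s.
by rewrite !(pair_prod_perm _ pM) pair_prod_swap // (junta_swap _ Sf) // mulNr.
Qed.

(** * Averaging over a block and multiplication by a variable *)

Definition fixed_in i : K := \sum_(v | (bl v == i) && (v \notin A)) (F v)%:R.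

(** On 0/1 values [(x_a - x_b) * (x_a + x_b) = x_a - x_b]: where the product is nonzero, each pair
    contributes exactly 1. *)
Lemma sum_ends M i s : matching M ->
  (\sum_(v <- ends M | bl v == i) (s v)%:R) * pair_prod M s
  = (pairs_in i M)%:R * pair_prod M s.
Proof.
elim: M => [|[a b] M IH]; first by rewrite big_nil !mul0r.
rewrite matching_cons => /and5P[_ _ _ _ /and3P[_ /eqP ab mM]].
rewrite pair_prod_cons /pairs_in /= -/(ends M) -/(pairs_in i M) !big_cons -ab.
have := IH mM; set S := \sum_(v <- _ | _) _; set p := pair_prod M s => e.
rewrite natrD; case: (bl a == i) => /=; last first.
  by rewrite add0r mulrCA e mulrCA.
transitivity (((s a)%:R - (s b)%:R) * ((s a)%:R + (s b)%:R) * p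
    + ((s a)%:R - (s b)%:R) * (S * p)); first by ring.
by rewrite e; case: (s a); case: (s b) => /=; ring.
Qed.

(** The block sum splits into frozen, matched and free unmatched variables; [F] determines the first
    part and [sum_ends] the second. *)
Lemma sum_free M i s : matching M -> agrees s ->
  (\sum_(v | [&& bl v == i, v \in A & v \notin ends M]) (s v)%:R) * pair_prod M s
  = (cnt i s - ((pairs_in i M)%:R + fixed_in i)) * pair_prod M s.
Proof.
move=> mM sF; rewrite mulrBl mulrDl -sum_ends // -mulrDl -mulrBl; congr (_ * _).
rewrite /cnt [in RHS](bigID (fun v => v \in A)) /=.
rewrite [in RHS](bigID (fun v => v \in ends M)) /=.
have -> : fixed_in i = \sum_(v | (bl v == i) && (v \notin A)) (s v)%:R.
  apply: eq_bigr => v /andP[_ vA].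
  by have := forallP sF v; rewrite (negbTE vA) => /eqP ->.
have /andP[uM /allP allM] := mM.
have -> : \sum_(v <- ends M | bl v == i) (s v)%:R
    = \sum_(v | (bl v == i) && (v \in A) && (v \in ends M)) (s v)%:R :> K.
  rewrite -big_filter big_uniq ?filter_uniq //; apply: eq_bigl => v.
  rewrite mem_filter -andbA; congr (_ && _); apply/esym.
  rewrite andb_idl // endsE => /hasP[ab /allM /and3P[aA bA _]].
  by case/orP => /eqP ->.
under [in LHS]eq_bigl do rewrite andbA.
by ring.
Qed.

(** Summing [x_c = x_v + (x_c - x_v)] over [P] writes [#|P| * x_c] as [cnt i s - nu] plus
    differences; adding the vanishing integral replaces [cnt i] by [kap i]. *)
Lemma wsum_average i c (P : pred V) nu psi f B : (0 < #|P|)%N ->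
  (forall s, agrees s ->
     (\sum_(v | P v) (s v)%:R) * psi s = (cnt i s - nu) * psi s) ->
  wsum (fun s => (kap i - cnt i s) * (psi s * f s)) = 0 ->
  `|wsum (fun s => psi s * f s)| <= B ->
  (forall v, P v -> `|wsum (fun s => ((s c)%:R - (s v)%:R) * psi s * f s)| <= B) ->
  `|wsum (fun s => (s c)%:R * psi s * f s)| <= (`|kap i - nu| + #|P|%:R) * B.
Proof.
move=> P0 avg T0 leB leBv; set X := wsum _.
have e : #|P|%:R * X = (kap i - nu) * wsum (fun s => psi s * f s)
    + \sum_(v | P v) wsum (fun s => ((s c)%:R - (s v)%:R) * psi s * f s).
  rewrite -wsum_sum -wsum_scale -[LHS]addr0 -[X in _ + X = _]T0 -wsum_scale -!wsum_add.
  apply: eq_wsum => s sF; rewrite -!mulr_suml sumrB sumr_const.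
  rewrite [X in _ = _ + X * _]mulrBl avg // -mulr_natl; ring.
(* Since [#|P|] is at least 1, the bound on [#|P| * X] also bounds [X]. *)
have lX : `|X| <= #|P|%:R * `|X| by rewrite ler_peMl // ler1n.
apply: (le_trans lX); rewrite -[#|P|%:R in X in X <= _]ger0_norm ?ler0n // -normrM e.
apply: (le_trans (ler_normD _ _)); rewrite [leRHS]mulrDl lerD //.
  by rewrite normrM ler_wpM2l.
apply: (le_trans (ler_norm_sum _ _ _)); apply: (le_trans (ler_sum _ leBv)).
by rewrite sumr_const mulr_natl.
Qed.

Section MulVar.
Variables (D : nat) (k0 : K) (f : asg -> K) (B : K).
Hypothesis f_low : low_degree D f.
Hypothesis room : forall i, (3 * D < #|in_block i A|)%N.
Hypothesis kap_le : forall i, `|kap i| <= k0.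
Hypothesis B_ge0 : 0 <= B.
Hypothesis f_small : forall M, matching M -> `|wsum (fun s => pair_prod M s * f s)| <= B.

Let C1 : K := k0 + (3 * #|V|).+1%:R.

Lemma shift_le i (m : nat) (P : pred V) : (m <= D.+1)%N ->
  `|kap i - (m%:R + fixed_in i)| + #|P|%:R <= C1.
Proof.
move=> mD; rewrite /C1.
have DV : (D.+1 <= #|V|.+1)%N.
  have := leq_trans (room i) (max_card _); move: (#|V|) => k ?; lia.
have fV : `|fixed_in i| <= #|V|%:R.
  rewrite /fixed_in -natr_sum normr_nat ler_nat.
  apply: (@leq_trans (\sum_(v | (bl v == i) && (v \notin A)) 1)%N).
    by apply: leq_sum => v _; apply: leq_b1.
  by rewrite sum1_card max_card.
have mV : m%:R <= #|V|.+1%:R :> K by rewrite ler_nat (leq_trans mD).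
have PV : #|P|%:R <= #|V|%:R :> K by rewrite ler_nat max_card.
have := ler_normB (kap i) (m%:R + fixed_in i).
have := ler_normD (m%:R : K) (fixed_in i); rewrite normr_nat => h1 h2.
have := kap_le i.
have -> : (3 * #|V|).+1%:R = #|V|.+1%:R + #|V|%:R + #|V|%:R :> K.
  by rewrite -!natrD; congr (_%:R); lia.
by move: h1 h2 fV mV PV; move: `|_| `|_| `|_| `|_| => *; lra.
Qed.

Lemma C1_ge1 i : 1 <= C1.
Proof.
rewrite /C1 -natr1; have := le_trans (normr_ge0 _) (kap_le i).
by have : 0 <= (3 * #|V|)%:R :> K by []; lra.
Qed.

(* Averaging [x_c = x_v + (x_c - x_v)] over the free unmatched [v] of the block: the
   first term is constant by [sum_free], the second enlarges the matching by [(c, v)]. *)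
Lemma mul_var_unmatched M c : matching M -> (pairs_in (bl c) M <= D)%N ->
  c \in A -> c \notin ends M ->
  `|wsum (fun s => (s c)%:R * pair_prod M s * f s)| <= C1 * B.
Proof.
move=> mM MD cA cM.
pose P := [pred v | [&& bl v == bl c, v \in A & v \notin ends M]].
apply: le_trans (_ : (`|kap (bl c) - ((pairs_in (bl c) M)%:R + fixed_in (bl c))|
    + #|P|%:R) * B <= _); last first.
  by rewrite ler_wpM2r // shift_le // leqW.
apply: wsum_average.
- by apply/card_gt0P; exists c; rewrite !inE eqxx cA cM.
- by move=> s; apply: sum_free.
(* The matching covers at most [2 * D] variables of the block and [f] accounts for [D] more, hence
   the 3 in [room]. *)
- apply: (proj1 f_low _ _ _ (@junta_pair_prod M)).
  have := card_in_block_ends (bl c) mM; have := room (bl c).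
  by move: (#|_|) (#|_|) (pairs_in _ _) MD => *; lia.
- exact: f_small.
move=> v /and3P[/eqP vc vA vM].
have [->|vneqc] := eqVneq v c.
  by rewrite /wsum big1 ?normr0 // => s _; rewrite subrr !mul0r mulr0.
rewrite (@eq_wsum _ (fun s => pair_prod ((c, v) :: M) s * f s)) => [|s _];
  last by rewrite pair_prod_cons.
by apply: f_small; rewrite matching_cons eq_sym vneqc cM vM cA vA vc eqxx.
Qed.

(* As [x_a (x_a - x_b) = x_a - x_a x_b], it suffices to average
   [x_b = x_v + (x_b - x_v)] against [x_a * pair_prod M]. *)
Lemma mul_var_matched a b M : matching ((a, b) :: M) ->
  (pairs_in (bl a) ((a, b) :: M) <= D)%N ->
  `|wsum (fun s => (s a)%:R * pair_prod ((a, b) :: M) s * f s)| <= (C1 + C1 ^+ 2) * B.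
Proof.
move=> mabM MD; have := mabM.
rewrite matching_cons => /and5P[ab aM bM aA /and3P[bA /eqP eab mM]].
have MD' : (pairs_in (bl a) M < D)%N by move: MD; rewrite /pairs_in /= eqxx.
have la := mul_var_unmatched mM (ltnW MD') aA aM.
have le1 := C1_ge1 (bl a).
have C1B0 : 0 <= C1 * B by rewrite mulr_ge0 // (le_trans _ le1).
have lb : `|wsum (fun s => (s b)%:R * ((s a)%:R * pair_prod M s) * f s)| <= C1 * (C1 * B).
  (* [a] is left out because the factor [s a] already depends on it. Where [s a] is 1, it takes one
     unit of the free sum, hence the [.+1] in the shift. *)
  pose P := [pred v | (v != a) && [&& bl v == bl a, v \in A & v \notin ends M]].
  apply: le_trans (_ : (`|kap (bl a) - ((pairs_in (bl a) M).+1%:R + fixed_in (bl a))|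
      + #|P|%:R) * (C1 * B) <= _); last first.
    by apply: ler_wpM2r => //; apply: shift_le; apply: leq_trans MD' _.
  apply: wsum_average.
  - by apply/card_gt0P; exists b; rewrite !inE eq_sym ab -eab eqxx bA bM.
  - move=> s sF; have := sum_free (bl a) mM sF.
    rewrite (bigD1 a) ?eqxx ?aA //=.
    rewrite (eq_bigl P) => [|v]; last by rewrite /= andbC.
    rewrite -natr1; case: (s a) => /= e; last by rewrite !mul0r !mulr0.
    rewrite !mul1r; move: e; rewrite mulrDl mul1r => e.
    by apply: (addrI (pair_prod M s)); rewrite e; ring.
  - apply: (proj1 f_low _ (a |: [set v in ends M])).
      move=> s s' ss'; rewrite (ss' a) ?setU11 //; congr (_ * _).
      by apply: junta_pair_prod => v vM; rewrite ss' // inE vM orbT.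
    have : (#|in_block (bl a) (a |: [set v in ends M])|
        <= (#|in_block (bl a) [set v in ends M]|).+1)%N.
      apply: leq_trans (_ : #|a |: in_block (bl a) [set v in ends M]| <= _)%N.
        by apply: subset_leq_card; apply/subsetP => v; rewrite !inE; case: (v == a).
      by rewrite cardsU1 -add1n leq_add2r leq_b1.
    have := card_in_block_ends (bl a) mM; have := room (bl a).
    by move: (#|_|) (#|_|) (#|_|) (pairs_in _ _) MD' => *; lia.
  - exact: la.
  move=> v /and4P[va /eqP vbl vA vM].
  have [->|vneqb] := eqVneq v b.
    by rewrite /wsum big1 ?normr0 // => s _; rewrite subrr !mul0r mulr0.
  have mbv : matching ((b, v) :: M).
    by rewrite matching_cons eq_sym vneqb bM vM bA vA -eab vbl eqxx.
  (* The difference [s b - s v] restores a matching, with pair [(b, v)], in which [a] is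
     unmatched. *)
  rewrite (@eq_wsum _ (fun s => (s a)%:R * pair_prod ((b, v) :: M) s * f s)).
    apply: mul_var_unmatched => //; first by move: MD; rewrite /pairs_in /= -eab.
    by rewrite /= !inE !negb_or ab eq_sym va.
  by move=> s _; rewrite pair_prod_cons; ring.
rewrite (@eq_wsum _ (fun s => (s a)%:R * pair_prod M s * f s
    + -1 * ((s b)%:R * ((s a)%:R * pair_prod M s) * f s))).
  rewrite wsum_add wsum_scale mulN1r (le_trans (ler_normB _ _)) //.
  by rewrite [leRHS]mulrDl expr2 -mulrA lerD.
by move=> s _; rewrite pair_prod_cons; case: (s a); case: (s b) => /=; ring.
Qed.

(** A frozen variable is a 0/1 constant, a free unmatched one costs [C1], and a matched one costs
    [C1 + C1 ^+ 2]. *)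
Lemma mul_var M c : matching M -> (forall i, (pairs_in i M <= D)%N) ->
  `|wsum (fun s => (s c)%:R * (pair_prod M s * f s))| <= (C1 + C1 ^+ 2) * B.
Proof.
move=> mM MD; have le1 := C1_ge1 (bl c).
have C0 : 0 <= C1 * B by rewrite mulr_ge0 // (le_trans _ le1).
have C20 : 0 <= C1 ^+ 2 * B by rewrite mulr_ge0 // exprn_ge0 // (le_trans _ le1).
have lC : B <= C1 * B by rewrite ler_peMl.
have le2 : C1 * B <= (C1 + C1 ^+ 2) * B by rewrite [leRHS]mulrDl lerDl.
have [cA|cA] := boolP (c \in A); last first.
  rewrite (@eq_wsum _ (fun s => (F c)%:R * (pair_prod M s * f s))) => [|s /forallP/(_ c)].
    rewrite wsum_scale; apply: le_trans le2; apply: le_trans lC.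
    by case: (F c); rewrite ?mul1r ?mul0r ?normr0 ?f_small.
  by rewrite (negbTE cA) => /eqP ->.
have [cM|cM] := boolP (c \in ends M); last first.
  apply: le_trans le2; rewrite (@eq_wsum _ (fun s => (s c)%:R * pair_prod M s * f s)).
    exact: mul_var_unmatched.
  by move=> s _; rewrite mulrA.
move: cM; rewrite endsE => /hasP[[a b] abM /=].
have pM := perm_to_rem abM; move: (rem _ _) pM => M' pM.
have mabM : matching ((a, b) :: M') by rewrite -(matching_perm pM).
have MD' i : (pairs_in i ((a, b) :: M') <= D)%N.
  by move: (MD i); rewrite /pairs_in (seq.permP pM).
have := mabM; rewrite matching_cons => /and5P[ab aM bM aA /and3P[bA /eqP eab mM']].
have mbaM : matching ((b, a) :: M').
  by rewrite matching_cons eq_sym ab aM bM aA bA eab eqxx.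
case/orP => /eqP ->.
  rewrite (@eq_wsum _ (fun s => (s a)%:R * pair_prod ((a, b) :: M') s * f s)).
    exact: mul_var_matched.
  by move=> s _; rewrite (pair_prod_perm _ pM) mulrA.
(* For the second end of a pair, reversing the pair brings it to the front at the cost of a sign. *)
rewrite (@eq_wsum _ (fun s => -1 * ((s b)%:R * pair_prod ((b, a) :: M') s * f s))).
  rewrite wsum_scale mulN1r normrN; apply: mul_var_matched => //.
  by move: (MD' (bl b)); rewrite /pairs_in /= eab.
by move=> s _; rewrite (pair_prod_perm _ pM) !pair_prod_cons; ring.
Qed.

End MulVar.

End Functional.

(** * Closed form and nonvanishing of the total mass *)

Section TotalMass.
Local Open Scope ring_scope.

Variables (V I : finType) (bl : V -> I) (K : realFieldType) (kap : I -> K).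
Hypothesis kap_notnat : forall i k, kap i != k%:R.

Local Notation asg := {ffun V -> bool}.
Implicit Types (A : {set V}) (F : V -> bool).

Definition set_at F a (x : bool) v := if v == a then x else F v.

Lemma agrees_set_at A F a x (s : asg) : a \in A ->
  agrees (A :\ a) (set_at F a x) s = agrees A F s && (s a == x).
Proof.
move=> aA; apply/forallP/andP => [sF|[/forallP sF sa] v].
  split; last by have := sF a; rewrite !inE /set_at eqxx.
  by apply/forallP => v; have := sF v; rewrite !inE /set_at;
     case: (eqVneq v a) => // ->; rewrite aA.
by have := sF v; rewrite !inE /set_at; case: (eqVneq v a) => // ->; rewrite sa.
Qed.

(* The value of [sum_k (-1)^(m-k) 'C(m, k) / (t - k)]. *)
Definition zeta (m : nat) (t : K) : K := m`!%:R / \prod_(k < m.+1) (t - k%:R).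

(** This is the recursion of iterated differences of [1 / t]. Splitting off the first or the last
    factor of the longer product relates the products for [t - 1] and [t]. *)
Lemma zeta_rec m t : (forall k, t != k%:R) ->
  zeta m.+1 t = zeta m (t - 1) - zeta m t.
Proof.
move=> t_notnat; rewrite /zeta.
have e0 : \prod_(k < m.+2) (t - k%:R) = t * \prod_(k < m.+1) (t - 1 - k%:R) :> K.
  rewrite big_ord_recl subr0; congr (_ * _); apply: eq_bigr => k _.
  by rewrite lift0 -natr1; ring.
have e : t * \prod_(k < m.+1) (t - 1 - k%:R)
    = \prod_(k < m.+1) (t - k%:R) * (t - m.+1%:R) :> K.
  by rewrite -e0 big_ord_recr.
rewrite e0.
have nz : t * \prod_(k < m.+1) (t - 1 - k%:R) != 0.
  rewrite e mulf_neq0 ?subr_eq0 //; apply/prodf_neq0 => k _.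
  by rewrite subr_eq0.
have := nz; rewrite mulf_eq0 => /norP[t0 Q0]; have := nz.
rewrite e mulf_eq0 => /norP[P0 tm0].
move: e P0 Q0; move: (\prod_(_ < _) _) (\prod_(_ < _) _) => P Q e P0 Q0.
have eQ : Q = P * (t - m.+1%:R) / t by rewrite -e; field.
rewrite eQ factS natrM; move: tm0; rewrite -natr1 => tm0; field.
by rewrite P0 t0 tm0.
Qed.

(** Induction on the free variables: freezing [a] to 0 or 1 splits the sum, the value 1 flips the
    sign and shifts the argument of its block by one, and [zeta_rec] recombines the halves. *)
Lemma total_mass A F : wsum bl kap A F (fun=> 1) =
  \prod_(v | v \notin A) (-1) ^+ F v * (-1) ^+ #|A| *
  \prod_i zeta #|in_block bl i A| (kap i - fixed_in bl K A F i).
Proof.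
move mA : #|A| => m; elim: m A F mA => [|m IH] A F mA.
  have A0 : A = set0 by apply: cards0_eq.
  have block0 i : in_block bl i A = set0.
    by apply/setP => v; rewrite A0 !inE.
  rewrite /wsum (bigD1 (finfun F)) //= big1 => [|s sF]; last first.
    rewrite mulr1 /weight; case: (boolP (agrees A F s)) => [/forallP eF|_];
      last by rewrite !mul0r.
    case/eqP: sF; apply/ffunP => v; rewrite ffunE.
    by have := eF v; rewrite A0 inE => /eqP.
  rewrite addr0 !mulr1 /weight.
  have -> : agrees A F (finfun F).
    by apply/forallP => v; rewrite ffunE eqxx orbT.
  rewrite mul1r; congr (_ * _).
    by apply: eq_big => v; rewrite ?A0 ?inE // ffunE.
  apply: eq_bigr => i _; rewrite block0 cards0 /zeta big_ord1 subr0 fact0 mul1r.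
  congr (_ - _)^-1; apply: eq_big => v; last by rewrite ffunE.
  by rewrite A0 inE andbT.
have [a aA] : exists a, a \in A by apply/card_gt0P; rewrite mA.
have mAa : #|A :\ a| = m by move: mA; rewrite (cardsD1 a) aA => -[].
have split01 : wsum bl kap A F (fun=> 1) =
    wsum bl kap (A :\ a) (set_at F a false) (fun=> 1)
    + wsum bl kap (A :\ a) (set_at F a true) (fun=> 1).
  rewrite /wsum -big_split; apply: eq_bigr => s _.
  rewrite /weight !agrees_set_at //.
  by case: (agrees _ _ _); case: (s a) => /=; ring.
have sgn x : \prod_(v | v \notin A :\ a) (-1) ^+ set_at F a x v
    = (-1) ^+ x * \prod_(v | v \notin A) (-1) ^+ F v :> K.
  rewrite (bigD1 a) ?inE ?eqxx //= /set_at eqxx; congr (_ * _).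
  apply: eq_big => v; first by rewrite !inE negb_and negbK; 
    case: (eqVneq v a) => [->|_]; rewrite ?aA ?andbT ?andbF.
  by case/andP => _ /negbTE ->.
have fix_at x i : fixed_in bl K (A :\ a) (set_at F a x) i =
    (bl a == i)%:R * x%:R + fixed_in bl K A F i.
  rewrite /fixed_in big_mkcond (bigD1 a) //= !inE eqxx andbT /set_at eqxx.
  congr (_ + _); first by case: (bl a == i); rewrite ?mul1r ?mul0r.
  rewrite -big_mkcondr /=; apply: eq_big => v; last by case/andP => /negbTE ->.
  by rewrite !inE; case: (eqVneq v a) => //= ->; rewrite aA andbF.
have blk i : #|in_block bl i A| = ((bl a == i) + #|in_block bl i (A :\ a)|)%N.
  rewrite (cardsD1 a) !inE aA /=; congr (_ + _)%N; apply: eq_card => v.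
  by rewrite !inE andbA.
rewrite split01 !IH // !sgn !(bigD1 (P := xpredT) (bl a)) //= !fix_at blk eqxx add1n.
rewrite zeta_rec; last first.
  move=> k; rewrite subr_eq /fixed_in -natr_sum -natrD; exact: kap_notnat.
have rest x : \prod_(i | i != bl a) zeta #|in_block bl i (A :\ a)|
      (kap i - fixed_in bl K (A :\ a) (set_at F a x) i)
    = \prod_(i | i != bl a) zeta #|in_block bl i A| (kap i - fixed_in bl K A F i).
  apply: eq_bigr => i ia; rewrite fix_at blk eq_sym (negbTE ia).
  by rewrite mul0r add0r.
rewrite !rest /= !mul1r add0r [(-1) ^+ m.+1]exprS.
have -> : kap (bl a) - fixed_in bl K A F (bl a) - 1
    = kap (bl a) - (1 + fixed_in bl K A F (bl a)) by ring.
by ring.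
Qed.

(** The final inequality divides by this mass. No denominator in the product formula vanishes,
    because [kap i] is never a natural number. *)
Lemma total_mass_neq0 A F : wsum bl kap A F (fun=> 1) != 0.
Proof.
rewrite total_mass mulf_neq0 //.
  rewrite mulf_neq0 ?signr_eq0 //; apply/prodf_neq0 => v _.
  by rewrite signr_eq0.
apply/prodf_neq0 => i _; rewrite /zeta mulf_neq0 //.
  by rewrite pnatr_eq0 -lt0n fact_gt0.
rewrite invr_eq0; apply/prodf_neq0 => k _.
rewrite -addrA -opprD subr_eq0 /fixed_in -natr_sum -natrD; exact: kap_notnat.
Qed.

End TotalMass.

(** * Greedy choice of literals meeting all wide sets *)

Section Restriction.

Variables (V : finType).
Local Notation lit := (V * bool)%type.
Implicit Types (G L : {set lit}) (fam : {set {set lit}}) (B : {set V}).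

(* A literal [(v, b)] has value [v (+) b]; a set [G] of literals is to be falsified. *)
Definition consistent G := forall v, ~~ (((v, false) \in G) && ((v, true) \in G)).
Definition lits B : {set lit} := [set l | l.1 \in B].
Definition missed fam G := [set L in fam | [disjoint L & G]].

Lemma card_lits B : #|lits B| = (2 * #|B|)%N.
Proof.
have -> : lits B = setX B [set: bool] by apply/setP => l; rewrite !inE andbT.
by rewrite cardsX cardsT card_bool mulnC.
Qed.

(** Double counting of incidences: if every literal of [W] lay in less than a fraction [1 / Q] of
    the sets, these could not all have [q] literals in [W]. *)
Lemma popular_literal (W : {set lit}) fam (q Q : nat) :
  (0 < Q * q)%N -> (#|W| <= Q * q)%N -> (0 < #|fam|)%N ->
  (forall L, L \in fam -> (q <= #|L :&: W|)%N) ->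
  exists2 l, l \in W & (#|fam| <= Q * #|[set L in fam | l \in L]|)%N.
Proof.
move=> Qq WQ fam0 wide.
case: (pickP [pred l in W | #|fam| <= Q * #|[set L in fam | l \in L]|]%N) => [l|none].
  by case/andP => lW le; exists l.
have count2 : (\sum_(l in W) #|[set L in fam | l \in L]|
    = \sum_(L in fam) #|L :&: W|)%N.
  under eq_bigr do rewrite -sum1dep_card big_mkcondr.
  rewrite exchange_big; apply: eq_bigr => L _.
  by rewrite -big_mkcondr sum1dep_card; apply: eq_card => l; rewrite !inE andbC.
have lo : (q * #|fam| <= \sum_(L in fam) #|L :&: W|)%N.
  by rewrite mulnC -sum_nat_const; apply: leq_sum => L; apply: wide.
have hi : (Q * \sum_(l in W) #|[set L in fam | l \in L]| <= #|W| * #|fam|.-1)%N.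
  rewrite big_distrr -sum_nat_const; apply: leq_sum => l lW.
  have := none l; rewrite /= lW /= => /negbT; rewrite -ltnNge => lt.
  by rewrite -ltnS prednK.
have := leq_trans (leq_mul (leqnn Q) lo).
rewrite -count2 => /(_ _ hi) /leq_trans /(_ (leq_mul WQ (leqnn _))).
by rewrite mulnA leq_pmul2l // -ltnS prednK // ltnn.
Qed.

(** Each step adds a popular literal, which shrinks the missed family by a factor [(Q - 1) / Q].
    Every variable already used removes two literals, hence the margin [2 * t]. *)
Lemma greedy_step B fam (q Q t : nat) :
  (0 < Q * q)%N -> (2 * #|B| <= Q * q)%N ->
  (forall L, L \in fam -> (q + 2 * t <= #|L :&: lits B|)%N) ->
  exists G, [/\ consistent G, (#|G| <= t)%N, G \subset lits B
    & (Q ^ t * #|missed fam G| <= Q.-1 ^ t * #|fam|)%N].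
Proof.
move=> Qq BQ; elim: t => [|t IH] wide.
  exists set0; split; rewrite ?cards0 ?sub0set //.
    by move=> v; rewrite !inE.
  by rewrite !mul1n subset_leq_card //; apply/subsetP => L; rewrite inE => /andP[].
have [|G [cG Gt GB le]] := IH.
  by move=> L /wide; apply: leq_trans; rewrite leq_add2l leq_mul2l leqnSn.
have [Gfam0|Gfam] := posnP #|missed fam G|.
  by exists G; split; rewrite ?Gfam0 ?muln0 // (leq_trans Gt).
pose W := [set l in lits B | ((l.1, false) \notin G) && ((l.1, true) \notin G)].
have [||l lW lpop] := popular_literal (W := W) Qq _ Gfam.
- apply: leq_trans BQ; rewrite -card_lits; apply: subset_leq_card.
  by apply/subsetP => l; rewrite inE => /andP[].
- move=> L; rewrite inE => /andP[Lfam _]; have := wide L Lfam.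
  have : (#|L :&: lits B| <= #|L :&: W| + 2 * t)%N.
    pose G1 := [set l.1 | l in G].
    apply: (@leq_trans #|(L :&: W) :|: lits G1|).
      apply: subset_leq_card; apply/subsetP => l; rewrite !inE => /andP[-> ->] /=.
      have [/negP lG|] := boolP (l.1 \in G1); rewrite ?orbT // orbF => /negP lG.
      by apply/andP; split; apply/negP => h; apply: lG; apply/imsetP; eexists; eauto.
    apply: leq_trans (leq_card_setU _ _) _; rewrite leq_add2l card_lits leq_mul2l /=.
    exact: leq_trans (leq_imset_card _ _) Gt.
  by move=> h1 h2; lia.
move: lW; rewrite inE => /and3P[lB l0 l1].
exists (l |: G); split.
- case: l l0 l1 {lpop lB} => u x /= l0 l1 v; rewrite !inE !xpair_eqE.
  case: eqVneq => [->|_]; last exact: cG.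
  by rewrite (negbTE l0) (negbTE l1) !orbF; case: x.
- by rewrite cardsU1 -add1n leq_add // leq_b1.
- by rewrite subUset sub1set lB.
have : (#|missed fam G| = #|[set L in missed fam G | l \in L]| + #|missed fam (l |: G)|)%N.
  rewrite -(cardsID [set L : {set lit} | l \in L] (missed fam G)); congr (_ + _)%N.
    by apply: eq_card => L; rewrite !inE.
  apply: eq_card => L; rewrite !inE -!setI_eq0 setIUr setU_eq0.
  have -> : (L :&: [set l] == set0) = (l \notin L).
    by rewrite setI_eq0 disjoint_sym disjoints1.
  by rewrite andbCA.
move: lpop le; set m := #|missed _ _|; set m1 := #|[set _ in _ | _]|.
set m2 := #|missed _ (_ |: _)| => lpop le e.
have {}lpop : (Q * m2 <= Q.-1 * m)%N.
  by have Q0 : (0 < Q)%N by [case: (Q) Qq]; nia.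
rewrite expnSr [in X in (_ <= X)%N]expnS -!mulnA.
apply: leq_trans (leq_mul (leqnn _) lpop) _.
by rewrite mulnCA leq_mul2l le orbT.
Qed.

(** Bernoulli's inequality for [(1 + 1 / p) ^ k] with denominators cleared. *)
Lemma bernoulli_nat p k : ((p + k) * p ^ k <= p * p.+1 ^ k)%N.
Proof.
elim: k => [|k IH]; first by rewrite addn0.
rewrite !expnSr !mulnA; apply: leq_trans (leq_mul IH (leqnn p.+1)).
by rewrite -!mulnA ![(p ^ k * _)%N]mulnC !mulnA leq_mul2r; apply/orP; right; nia.
Qed.

(** Bernoulli with exponent [Q] gives [2 * (Q - 1) ^ Q <= Q ^ Q], which is raised to the power
    [s]. *)
Lemma expn_pred_half Q s : (0 < Q)%N -> (2 ^ s * Q.-1 ^ (Q * s) <= Q ^ (Q * s))%N.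
Proof.
case: Q => // p _; rewrite !expnM -expnMn /=.
case: s => [|s] //; rewrite leq_exp2r //.
case: (posnP p) => [->|p_gt0]; first by rewrite exp1n exp0n.
rewrite -(leq_pmul2l p_gt0); apply: leq_trans (bernoulli_nat p p.+1).
by rewrite mulnA leq_mul2r; apply/orP; right; lia.
Qed.

(** After [Q * s] steps the missed fraction is at most [2 ^ (-s)], so fewer than one set is
    missed. *)
Lemma greedy_hit B fam (q Q s : nat) :
  (0 < Q * q)%N -> (2 * #|B| <= Q * q)%N -> (#|fam| < 2 ^ s)%N ->
  (forall L, L \in fam -> (q + 2 * (Q * s) <= #|L :&: lits B|)%N) ->
  exists G, [/\ consistent G, (#|G| <= Q * s)%N, G \subset lits B
    & forall L, L \in fam -> exists2 l, l \in L & l \in G].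
Proof.
move=> Qq BQ few wide.
have [G [cG Gs GB le]] := greedy_step Qq BQ wide.
exists G; split=> // L Lfam.
have Q0 : (0 < Q)%N by case: (Q) Qq.
have [missed0|missed_gt0] := posnP #|missed fam G|.
  have := cards0_eq missed0 => /setP/(_ L); rewrite !inE Lfam /= => /negbT.
  by rewrite -setI_eq0 => /set0Pn[l]; rewrite inE => /andP[]; exists l.
have := expn_pred_half s Q0.
have : (0 < Q ^ (Q * s))%N by rewrite expn_gt0 Q0.
move: le few; set X := (Q ^ _)%N; set Y := (Q.-1 ^ _)%N => le few X0 YX.
have X_le : (X <= Y * #|fam|)%N by apply: leq_trans le; rewrite leq_pmulr.
have Y0 : (0 < Y)%N by case: posnP X_le => // ->; rewrite mul0n leqNgt X0.
have := leq_ltn_trans X_le (leq_trans _ YX).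
by rewrite mulnC ltn_pmul2r // few ltnn => /(_ isT).
Qed.

End Restriction.

(** * Simultaneous restriction of all blocks *)

Section BlockRestriction.

Variables (V I : finType) (bl : V -> I).

(** The greedy choices of different blocks concern disjoint variables, so they combine without
    conflict. *)
Lemma block_restriction (fam : I -> {set {set V * bool}}) (q Q s : nat) :
  (0 < Q * q)%N -> (forall i, 2 * #|in_block bl i [set: V]| <= Q * q)%N ->
  (forall i, #|fam i| < 2 ^ s)%N ->
  (forall i L, L \in fam i ->
     (q + 2 * (Q * s) <= #|L :&: lits (in_block bl i [set: V])|)%N) ->
  exists (A : {set V}) (F : V -> bool),
    (forall i, (#|in_block bl i (~: A)| <= Q * s)%N)
    /\ forall i L, L \in fam i -> exists2 l, l \in L & (l.1 \notin A) && (F l.1 == l.2).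
Proof.
move=> Qq small few wide.
have [G HG] := fin_all_exists (fun i => greedy_hit Qq (small i) (few i) (wide i)).
have G_block i l : l \in G i -> bl l.1 = i.
  by have [_ _ /subsetP sG _] := HG i; move/sG; rewrite !inE => /eqP.
pose A := [set v | [forall i, ((v, false) \notin G i) && ((v, true) \notin G i)]].
exists A, (fun v => (v, true) \in G (bl v)); split=> [i|i L Lfam].
  have [_ Gs _ _] := HG i; apply: leq_trans Gs.
  apply: leq_trans (leq_imset_card (@fst _ _) _).
  apply: subset_leq_card; apply/subsetP => v; rewrite !inE.
  case/andP => /forallPn[j]; rewrite negb_and !negbK => vG /eqP vi.
  by case/orP: vG => vG; have /= e := G_block _ _ vG; rewrite -vi e;
    apply/imsetP; eexists; eauto.
have [cG _ _ /(_ L Lfam)[l lL lG]] := HG i; exists l => //.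
have li := G_block _ _ lG; move: lG li; case: l {lL} => v x /= lG li.
apply/andP; split.
  rewrite inE; apply/forallPn; exists i; rewrite negb_and !negbK.
  by case: x lG => ->; rewrite ?orbT.
rewrite li; have := cG v; case: x lG => -> //=.
by move/negbTE => ->.
Qed.

End BlockRestriction.

(** * Heights of single proof lines *)

Section Heights.
Variable n : nat.
Implicit Types ls : seq (line n).

Lemma heights_rcons ls l :
  heights (rcons ls l) = rcons (heights ls) (next_height (heights ls) l.2).
Proof. by rewrite /heights -cats1 foldl_cat. Qed.

Lemma size_heights ls : size (heights ls) = size ls.
Proof. by elim/last_ind: ls => // ls l IH; rewrite heights_rcons !size_rcons IH. Qed.

Lemma nth_heights ls t : (t < size ls)%N ->
  nth 0%N (heights ls) t
  = next_height (take t (heights ls)) (nth (0%R, RHyp n) ls t).2.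
Proof.
elim/last_ind: ls => // ls l IH; rewrite heights_rcons size_rcons ltnS => le_t.
rewrite !nth_rcons size_heights -cats1 takel_cat ?size_heights //.
case: ltngtP le_t => // [lt _|-> _]; first exact: IH.
by rewrite take_oversize // size_heights.
Qed.

End Heights.

(** * Evaluation of proof lines under the functional *)

Section Refutation.
Local Open Scope ring_scope.

Variables (n : nat) (lines : seq (line n)).
Local Notation cell := ('I_n * 'I_(2 * n))%type.
Local Notation asg := {ffun cell -> bool}.
Local Notation blk := (@fst 'I_n 'I_(2 * n)).
Variables (A : {set cell}) (F : cell -> bool) (D : nat) (Rq C : rat).

(* Blocks are indexed from 0, so this is the paper's [2^(-2^(i-1))]. *)
Definition root_val (i : 'I_n) : rat := (1 / 2) ^+ (2 ^ i).
Definition kappa (i : 'I_n) : rat := n%:R + root_val i.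

Definition lit_val (s : asg) (l : var_t n) : rat := (s l.1 (+) l.2)%:R.
Definition ev (s : asg) (p : Defs.poly n) : rat := p.@[fun k => lit_val s (enum_val k)].
(** Exponents are dropped: a positive power of a 0/1 value is that value. *)
Definition mon_lits (m : 'X_{1..nvars n}) : {set cell * bool} :=
  [set l : var_t n | m (enum_rank l) != 0%N].

Local Notation p_ t := (nth (0, RHyp n) lines t).1.
Local Notation rule_ t := (nth (0, RHyp n) lines t).2.
Local Notation matching := (matching blk A).
Local Notation phi := (@pair_prod cell rat).
Local Notation T := (wsum blk kappa A F).

Hypothesis n_gt0 : (0 < n)%N.
Hypothesis D_gt0 : (0 < D)%N.
Hypothesis room : forall i, (3 * D < #|in_block blk i A|)%N.
Hypothesis refutes : pcr_refutation lines.
Hypothesis killed_or_narrow : forall t m, (t < size lines)%N -> m \in msupp (p_ t) ->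
  (exists2 l, l \in mon_lits m & (l.1 \notin A) && (F l.1 == l.2))
  \/ (forall i, #|mon_lits m :&: lits (in_block blk i [set: cell])| <= D)%N.
Hypothesis scalars_le : forall t a b k l, (t < size lines)%N ->
  rule_ t = RLin n a b k l -> `|a| <= Rq /\ `|b| <= Rq.
Hypothesis C_lin : 2 * Rq <= C.
Let C1 : rat := (n%:R + 1) + (3 * #|{: cell}|).+1%:R.
Hypothesis C_mul : 1 + (C1 + C1 ^+ 2) <= C.

Lemma root_val_gt0 i : 0 < root_val i.
Proof. by rewrite exprn_gt0. Qed.

Lemma root_val_lt1 i : root_val i < 1.
Proof. by rewrite exprn_ilt1 // -lt0n expn_gt0. Qed.

(** [kappa i] lies strictly between [n] and [n + 1]. *)
Lemma kappa_notnat i k : kappa i != k%:R.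
Proof.
have := root_val_gt0 i; have := root_val_lt1 i; rewrite /kappa.
case: (leqP k n) => kn lt1 gt0; apply/eqP => e.
  by have : k%:R <= n%:R :> rat by [rewrite ler_nat]; lra.
by have : n.+1%:R <= k%:R :> rat by [rewrite ler_nat]; rewrite -natr1; lra.
Qed.

Lemma kappa_le i : `|kappa i| <= n%:R + 1.
Proof.
have := root_val_gt0 i; have := root_val_lt1 i => lt1 gt0.
have n0 : 0 <= n%:R :> rat by [].
by rewrite /kappa ger0_norm; lra.
Qed.

Lemma evX s v : ev s (X v) = lit_val s v.
Proof. by rewrite /ev /X mevalXU enum_rankK. Qed.

Lemma ev_ks s i : ev s (ks i) = cnt blk rat i s - n%:R.
Proof.
rewrite /ev /ks mevalB mevalC raddf_sum /=; congr (_ - _).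
transitivity (\sum_(i' | i' == i) \sum_(j < 2 * n) (s (i', j))%:R : rat).
  rewrite big_pred1_eq; apply: eq_bigr => j _.
  by rewrite /x [LHS]evX /lit_val addbF.
by rewrite pair_big_dep /=; apply: eq_big => [v|[]] //; rewrite andbT.
Qed.

(** A monomial with a falsified literal vanishes on the support; any other is a junta with at most
    [D] variables per block. *)
Lemma low_degree_ev t : (t < size lines)%N ->
  low_degree blk kappa A F D (fun s => ev s (p_ t)).
Proof.
move=> t_lt.
apply: (low_degree_ext (f := fun s => \sum_(m <- msupp (p_ t))
   (p_ t)@_m * \prod_k lit_val s (enum_val k) ^+ m k)) => [s _|].
  by rewrite /ev mevalE.
apply: low_degree_sum => m m_in; have [[l lm /andP[lA /eqP Fl]]|narrow] :=
  killed_or_narrow t_lt m_in.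
  apply: low_degree_ext (low_degree0 _ _ _ _ _) => s /forallP/(_ l.1).
  rewrite (negbTE lA) Fl => /eqP sl; rewrite (bigD1 (enum_rank l)) //= enum_rankK.
  by rewrite /lit_val sl addbb expr0n -[_ == _]negbK; move: lm; rewrite inE => ->;
     rewrite mul0r.
apply: (@junta_low_degree _ _ _ _ _ _ _ kappa_notnat D [set l.1 | l in mon_lits m]).
  move=> s s' ss'; apply: eq_bigr => k _.
  have [->|mk] := eqVneq (m k) 0%N; first by rewrite !expr0.
  rewrite /lit_val ss' //; apply/imsetP; exists (enum_val k) => //.
  by rewrite inE enum_valK.
move=> i; apply: leq_trans (narrow i); apply: leq_trans (leq_imset_card (@fst _ _) _).
apply: subset_leq_card; apply/subsetP => v; rewrite !inE => /andP[/imsetP[l lm ->] li].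
by apply/imsetP; exists l; rewrite // in_setI lm !inE.
Qed.

Lemma low_degree_const c : low_degree blk kappa A F D (fun=> c).
Proof.
apply: (@junta_low_degree _ _ _ _ _ _ _ kappa_notnat D set0) => // i.
by rewrite (_ : in_block _ _ _ = set0) ?cards0 //; apply/setP => v; rewrite !inE.
Qed.

(** Supplies the cofactor [ks i + root_val i] of the quadratic hypotheses; it is a combination of
    single-variable juntas and a constant. *)
Lemma low_degree_cnt i c : low_degree blk kappa A F D (fun s => cnt blk rat i s + c).
Proof.
apply: low_degree_add; last exact: low_degree_const.
apply: (low_degree_ext (f := fun s : asg =>
   \sum_(v <- enum {: cell}) ((v.1 == i)%:R : rat) * (s v)%:R)) => [s _|].
  rewrite big_enum /cnt [RHS]big_mkcond; apply: eq_bigr => v _.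
  by case: (_ == _); rewrite ?mul1r ?mul0r.
apply: low_degree_sum => v _.
apply: (@junta_low_degree _ _ _ _ _ _ _ kappa_notnat D [set v]) => [s s' -> //|j].
  by rewrite inE.
apply: leq_trans D_gt0; apply: (@leq_trans #|[set v]|); last by rewrite cards1.
by apply: subset_leq_card; apply/subsetP => u; rewrite !inE => /andP[].
Qed.

(** [ks i - root_val i] evaluates to [cnt - kappa], so the first clause of [low_degree] applies with
    [phi M] as the junta. *)
Lemma T_root i f M : low_degree blk kappa A F D f -> matching M ->
  (forall j, pairs_in blk j M <= D)%N ->
  T (fun s => phi M s * ((ev s (ks i) - root_val i) * f s)) = 0.
Proof.
move=> f_low mM MD.
have <- : -1 * 0 = 0 :> rat by rewrite mulr0.
rewrite -(proj1 f_low i _ _ (@junta_pair_prod _ _ M)); last first.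
  have := card_in_block_ends i mM; have := room i; have := MD i.
  by move: (#|_|) (#|_|) (pairs_in _ _ _) => *; lia.
rewrite -wsum_scale; apply: eq_wsum => s _; rewrite ev_ks /kappa; ring.
Qed.

Lemma T_phi_le M : matching M -> `|T (phi M)| <= `|T (fun=> 1)|.
Proof.
case: M => [|[a b] M] mM.
  by rewrite (@eq_wsum _ _ _ _ _ A F (phi [::]) (fun=> 1)) // => s _;
    rewrite /pair_prod big_nil.
have := mM; rewrite matching_cons => /and5P[_ _ _ aA /and3P[bA /eqP ab _]].
by rewrite (wsum_swap kappa F aA bA ab) ?normr0 // => s; apply: pair_prod_swap mM.
Qed.

Lemma root_valS i i' : val i' = (val i).+1 -> root_val i ^+ 2 = root_val i'.
Proof. by move=> e; rewrite /root_val -exprM mulnC -expnS -e. Qed.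

(** * Growth of the integrals along the refutation *)

Let eps : rat := `|T (fun=> 1)| * (1 / 2) ^+ (2 ^ n).

Lemma eps_ge0 : 0 <= eps.
Proof. by rewrite mulr_ge0 // exprn_ge0. Qed.

(** Every hypothesis combines terms [ks i - root_val i] with low-degree cofactors, except that the
    last one leaves the constant [root_val i ^+ 2]. *)
Lemma T_hyp M p : matching M -> (forall j, pairs_in blk j M <= D)%N -> inQ p ->
  `|T (fun s => phi M s * ev s p)| <= eps.
Proof.
move=> mM MD [[i [i0 ->]]|[[i [i' [ii' ->]]]|[i [i_last ->]]]].
- rewrite (@eq_wsum _ _ _ _ _ A F _ (fun s => phi M s * ((ev s (ks i) - root_val i) * 1))).
    by rewrite T_root ?normr0 ?eps_ge0 //; apply: low_degree_const.
  move=> s _; rewrite mulr1 /ev mevalB mevalC /root_val.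
  by have -> : nat_of_ord i = 0%N := i0.
(* With [r] for [root_val], this is [(ks_i - r_i) * (ks_i + r_i) - (ks_i' - r_i')], as
   [r_i ^ 2 = r_i']. *)
- rewrite (@eq_wsum _ _ _ _ _ A F _ (fun s => phi M s *
      ((ev s (ks i) - root_val i) * (cnt blk rat i s + (root_val i - n%:R)))
      + -1 * (phi M s * ((ev s (ks i') - root_val i') * 1)))).
    rewrite wsum_add wsum_scale !T_root ?mulr0 ?addr0 ?normr0 ?eps_ge0 //.
      exact: low_degree_const.
    exact: low_degree_cnt.
  move=> s _; rewrite [ev s _]mevalB rmorphXn /= -![meval _ _]/(ev s _).
  by rewrite -(root_valS ii') [ev s (ks i)]ev_ks; ring.
rewrite (@eq_wsum _ _ _ _ _ A F _ (fun s => phi M s *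
      ((ev s (ks i) - root_val i) * (cnt blk rat i s + (root_val i - n%:R)))
      + root_val i ^+ 2 * phi M s)).
  rewrite wsum_add wsum_scale T_root // ?add0r; last exact: low_degree_cnt.
  rewrite normrM normrX (gtr0_norm (root_val_gt0 i)) mulrC /eps.
  (* The last block has index [n - 1], so squaring doubles the exponent to [2 ^ n]. *)
  have -> : root_val i ^+ 2 = (1 / 2) ^+ (2 ^ n).
    rewrite /root_val -exprM -expnSr; congr (_ ^+ (2 ^ _)).
    by have -> : nat_of_ord i = n.-1 := i_last; rewrite prednK.
  by rewrite ler_wpM2r ?exprn_ge0 // T_phi_le.
move=> s _; rewrite [ev s _]rmorphXn /= -![meval _ _]/(ev s _).
by rewrite [ev s (ks i)]ev_ks; ring.
Qed.

Lemma C1_ge0 : 0 <= C1.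
Proof. by rewrite /C1 !addr_ge0. Qed.

Lemma C_ge1 : 1 <= C.
Proof.
apply: le_trans C_mul; have := C1_ge0 => ?.
by rewrite lerDl addr_ge0 // exprn_ge0.
Qed.

(** Strong induction over the lines, for all matchings at once because multiplication by a variable
    passes to larger ones. Each inference costs a factor of at most [C]. *)
Lemma line_small t M : (t < size lines)%N -> matching M ->
  `|T (fun s => phi M s * ev s (p_ t))| <= C ^+ nth 0%N (heights lines) t * eps.
Proof.
have C0 : 0 <= C by apply: le_trans C_ge1.
have B_ge0 k : 0 <= C ^+ k * eps by rewrite mulr_ge0 ?exprn_ge0 // eps_ge0.
have le_eps k : eps <= C ^+ k * eps.
  by rewrite ler_peMl ?eps_ge0 // exprn_ege1 // C_ge1.
have [_ valid _] := refutes.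
elim/ltn_ind: t M => t IH M t_lt mM.
(* A matching with more than [D] pairs in some block integrates to 0, so [M] may be assumed
   small. *)
have [/existsP[j Dj]|MD] := boolP [exists j, D < pairs_in blk j M]%N.
  by rewrite (proj2 (low_degree_ev t_lt) M j) ?normr0.
have {}MD j : (pairs_in blk j M <= D)%N.
  by rewrite leqNgt; apply/negP => Dj; case/negP: MD; apply/existsP; exists j.
rewrite nth_heights //; have := valid t t_lt; rewrite /valid_line.
case rt: (rule_ t) => [|v|c d|v k|a b k l] /=.
- by move=> hyp; rewrite mul1r T_hyp.
- move=> ->; rewrite /wsum big1 ?normr0 // => s _.
  rewrite [ev s _]mevalB rmorphXn /= -!/(ev s _) evX /lit_val.
  by case: (_ (+) _); rewrite /= ?expr1n ?expr0n /= subrr !mulr0.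
- move=> ->; rewrite /wsum big1 ?normr0 // => s _.
  rewrite [ev s _]mevalB mevalD meval1 -!/(ev s _) !evX /lit_val /=.
  by case: (s _); rewrite /= ?addr0 ?add0r subrr !mulr0.
- move=> [kt ->]; have k_lt := ltn_trans kt t_lt.
  rewrite nth_take // exprS -mulrA.
  set B := C ^+ _ * eps.
  have f_small M' : matching M' -> `|T (fun s => phi M' s * ev s (p_ k))| <= B.
    exact: IH.
  have mulv c := mul_var (low_degree_ev k_lt) room kappa_le (B_ge0 _) f_small c mM MD.
  have evk s : ev s (X v * p_ k) = lit_val s v * ev s (p_ k).
    by rewrite [LHS]mevalM -!/(ev s _) evX.
  (* The extra 1 pays for a barred variable, which evaluates to [1 - x]. *)
  apply: le_trans (_ : (1 + (C1 + C1 ^+ 2)) * B <= _); last by rewrite ler_wpM2r ?B_ge0.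
  rewrite [leRHS]mulrDl mul1r; case v2: v.2.
    rewrite (@eq_wsum _ _ _ _ _ A F _ (fun s => phi M s * ev s (p_ k)
      + -1 * ((s v.1)%:R * (phi M s * ev s (p_ k))))) => [|s _].
      by rewrite wsum_add wsum_scale mulN1r (le_trans (ler_normB _ _)) // lerD // f_small.
    by rewrite evk /lit_val v2; case: (s v.1) => /=; ring.
  rewrite (@eq_wsum _ _ _ _ _ A F _ (fun s => (s v.1)%:R * (phi M s * ev s (p_ k))))
    => [|s _].
    by apply: le_trans (mulv _) _; rewrite lerDr B_ge0.
  by rewrite evk /lit_val v2 addbF; ring.
move=> [kt lt ->]; have [k_lt l_lt] := (ltn_trans kt t_lt, ltn_trans lt t_lt).
have [aR bR] := scalars_le t_lt rt.
rewrite !nth_take // exprS -mulrA; set h := maxn _ _.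
have monoC i : (i <= h)%N -> C ^+ i * eps <= C ^+ h * eps.
  by move=> ih; rewrite ler_wpM2r ?eps_ge0 // ler_weXn2l // C_ge1.
have bk := le_trans (IH k kt M k_lt mM) (monoC _ (leq_maxl _ _)).
have bl := le_trans (IH l lt M l_lt mM) (monoC _ (leq_maxr _ _)).
rewrite (@eq_wsum _ _ _ _ _ A F _ (fun s => a * (phi M s * ev s (p_ k))
    + b * (phi M s * ev s (p_ l)))) => [|s _]; last first.
  by rewrite [ev s _]mevalD !mevalZ -!/(ev s _); ring.
rewrite wsum_add !wsum_scale (le_trans (ler_normD _ _)) // !normrM.
apply: le_trans (_ : (2 * Rq) * (C ^+ h * eps) <= _); last by rewrite ler_wpM2r ?B_ge0.
by rewrite -mulrA mulr_natl mulr2n lerD // ler_pM.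
Qed.

(** The empty matching and the last line, which is 1, bound the mass by [C ^+ h] times
    [2 ^ (-(2 ^ n))] times itself; the mass cancels. *)
Lemma height_exponential : 2 ^+ (2 ^ n) <= C ^+ pcr_height lines.
Proof.
have [lines0 _ last1] := refutes.
have last_lt : ((size lines).-1 < size lines)%N by rewrite prednK.
have := @line_small _ [::] last_lt isT.
rewrite nth_last last1 -size_heights nth_last -/(pcr_height lines).
rewrite (@eq_wsum _ _ _ _ _ A F _ (fun=> 1)) => [|s _]; last first.
  by rewrite /pair_prod big_nil mul1r /ev meval1.
have tau_gt0 : 0 < `|T (fun=> 1)|.
  by rewrite normr_gt0 total_mass_neq0 //; apply: kappa_notnat.
rewrite /eps mulrCA -[leLHS]mulr1 ler_pM2l // expr_div_n expr1n mul1r.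
by rewrite ler_pdivlMr ?exprn_gt0 // mul1r.
Qed.

End Refutation.

(** * Numerical estimates and transfer between number types *)

Lemma card_row n (i : 'I_n) :
  #|in_block (@fst 'I_n 'I_(2 * n)) i [set: 'I_n * 'I_(2 * n)]| = (2 * n)%N.
Proof.
rewrite -[RHS]card_ord -(card_imset _ (_ : injective (fun j : 'I_(2 * n) => (i, j)))).
  apply: eq_card => -[i' j]; rewrite !inE /=.
  apply/eqP/imsetP => [->|[j' _ [-> _]]] //; first by exists j.
by move=> j j' [].
Qed.

Lemma leq_expn2_uphalf n : (2 <= n)%N -> (n <= 2 ^ uphalf n)%N.
Proof.
move=> n2; have u_gt0 : (0 < uphalf n)%N by lia.
rewrite -(prednK u_gt0) expnS; have := ltn_expl (uphalf n).-1 (ltnSn 1).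
by lia.
Qed.

(** Uses [n <= 10 * 2 ^ k], [10 ^ 5 <= 2 ^ 17] and [17 + 5 * k <= n]. *)
Lemma leq_pow5_expn2 n : (40 <= n)%N -> (n ^ 5 <= 2 ^ n)%N.
Proof.
move=> n40; pose k := (n %/ 10)%N.
have nk : (n <= 10 * 2 ^ k)%N.
  have := ltn_expl k (ltnSn 1); have := ltn_ceil n (isT : 0 < 10)%N.
  by rewrite -/k; lia.
apply: (@leq_trans ((10 * 2 ^ k) ^ 5)); first by rewrite leq_exp2r.
rewrite expnMn -expnM; apply: (@leq_trans (2 ^ 17 * 2 ^ (k * 5))).
  by rewrite leq_mul2r; apply/orP; right; vm_compute.
by rewrite -expnD leq_exp2l // /k; lia.
Qed.

(** The left side is the cost of multiplication with [n * (2 * n)] cells, the right side that of a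
    linear combination; so the latter covers both rules. *)
Lemma quadratic_count n : (100 <= n)%N ->
  (1 + ((n + 1 + (3 * (n * (2 * n))).+1)
      + (n + 1 + (3 * (n * (2 * n))).+1) ^ 2) <= 2 * 2 ^ (2 ^ uphalf n))%N.
Proof.
move=> n100; apply: (@leq_trans (n ^ 5)).
  have c1 : (n + 1 + (3 * (n * (2 * n))).+1 <= 7 * (n * n))%N by nia.
  have c2 : ((n + 1 + (3 * (n * (2 * n))).+1) ^ 2 <= (7 * (n * n)) ^ 2)%N.
    by rewrite leq_exp2r.
  have : (1 + (7 * (n * n) + (7 * (n * n)) ^ 2) <= n ^ 5)%N.
    rewrite (_ : (n ^ 5 = n * (n * n) * (n * n))%N) -?[(_ ^ 2)%N]mulnn; last first.
      by rewrite !expnS expn0; lia.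
    by nia.
  by lia.
apply: leq_trans (leq_pow5_expn2 _) _; first by lia.
apply: (@leq_trans (2 ^ (2 ^ uphalf n))); last by rewrite leq_pmull.
by rewrite leq_exp2l // leq_expn2_uphalf //; lia.
Qed.

Lemma INR_expn2 k : INR (2 ^ k) = pow2 (INR k).
Proof.
rewrite /pow2 Rpower_pow; last by Lra.lra.
elim: k => [|k IH] //; rewrite expnS mulnE mult_INR IH /=; Lra.lra.
Qed.

Lemma pow2_le a b : Rle a b -> Rle (pow2 a) (pow2 b).
Proof. by move=> ab; apply: Rle_Rpower => //; Lra.lra. Qed.

Lemma INR_leq (k l : nat) : Rle (INR k) (INR l) -> (k <= l)%N.
Proof. by move/INR_le/ssrnat.leP. Qed.

Lemma half_le_uphalf n : Rle (Rdiv (INR n) 2) (INR (uphalf n)).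
Proof.
have : (n <= 2 * uphalf n)%N by lia.
by move/ssrnat.leP/le_INR; rewrite mulnE mult_INR /=; Lra.lra.
Qed.

Lemma uphalf_le n : Rle (INR (uphalf n)) (Rplus (Rdiv (INR n) 2) 1).
Proof.
have : (2 * uphalf n <= n + 2)%N by lia.
by move/ssrnat.leP/le_INR; rewrite mulnE mult_INR addnE plus_INR /=; Lra.lra.
Qed.

Lemma IZR_int_to_Z_pos (k : nat) : IZR (int_to_Z (Posz k)) = INR k.
Proof. by rewrite /= -INR_IZR_INZ. Qed.

Lemma Rabs_IZR_int_to_Z (z : int) : Rabs (IZR (int_to_Z z)) = INR `|z|%N.
Proof.
case: z => k.
  by rewrite IZR_int_to_Z_pos Rabs_pos_eq //; apply: pos_INR.
by rewrite /int_to_Z opp_IZR Rabs_Ropp -INR_IZR_INZ Rabs_pos_eq //; apply: pos_INR.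
Qed.

Lemma rat2R_norm_le (q : rat) (k : nat) :
  Rle (Rabs (rat2R q)) (INR k) -> (`|q| <= k%:R)%R.
Proof.
have den_gt0 : (0 < `|denq q|)%N by rewrite absz_gt0 denq_neq0.
have INRden : Rlt 0 (INR `|denq q|) by apply/lt_0_INR/ssrnat.ltP.
rewrite /rat2R Rabs_mult Rabs_inv !Rabs_IZR_int_to_Z => le.
have {}le : (`|numq q| <= k * `|denq q|)%N.
  apply: INR_leq; rewrite mulnE mult_INR.
  apply: (Rmult_le_reg_r (/ INR `|denq q|)); first exact: Rinv_0_lt_compat.
  by rewrite Rmult_assoc Rinv_r ?Rmult_1_r //; apply: Rgt_not_eq.
rewrite -{1}[q]divq_num_den normrM normfV ler_pdivrMr; last first.
  by rewrite normr_gt0 intr_eq0 denq_neq0.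
by rewrite -!intr_norm -!abszE pmulrn -natrM ler_nat.
Qed.

(** The margin of two between 2048 and 1024 absorbs the rounding in [n %/ 1024]. *)
Lemma monomials_few n m : (1024 <= n)%N ->
  Rle (INR m) (pow2 (Rmult (Rinv 2048) (INR n))) -> (m < 2 ^ (n %/ 1024))%N.
Proof.
move=> n_ge le; apply/ssrnat.ltP/INR_lt; apply: (Rle_lt_trans _ _ _ le).
rewrite INR_expn2; apply: Rpower_lt; first by Lra.lra.
have : (n < 2048 * (n %/ 1024))%N by lia.
move/ssrnat.ltP/lt_INR; rewrite mulnE mult_INR.
have -> : INR 2048 = IZR 2048 by rewrite INR_IZR_INZ.
Lra.lra.
Qed.

(** With [y = 2 ^ (n / 2)], the cofactor of [h] is at most [2 * y + 1 <= 4 * y], so [h >= y / 4],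
    the leading term of the bound; what is subtracted from it is nonnegative. *)
Lemma height_from_exponential n h : (1 < n)%N ->
  (2 ^ n <= (2 ^ uphalf n).+1 * h)%N -> Rle (height_bound 1 n) (INR h).
Proof.
move=> n_gt1 /ssrnat.leP/le_INR; rewrite mulnE mult_INR S_INR !INR_expn2.
set y := pow2 (Rdiv (INR n) 2) => le.
have INRn : Rlt 1 (INR n) by apply: (lt_INR 1); apply/ssrnat.ltP.
have y_ge1 : Rle 1 y.
  have -> : IZR 1 = pow2 (IZR 0) by rewrite /pow2 Rpower_O //; Lra.lra.
  by apply: pow2_le; Lra.lra.
have ey : pow2 (INR n) = Rmult y y.
  by rewrite /y /pow2 -Rpower_plus; congr Rpower; Lra.lra.
have eu : Rle (pow2 (INR (uphalf n))) (Rmult 2 y).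
  apply: Rle_trans (pow2_le (uphalf_le n)) _.
  by rewrite /pow2 Rpower_plus Rpower_1 -/(pow2 _) -/y; Lra.lra.
have h_ge0 := pos_INR h.
have yh : Rle (Rdiv y 4) (INR h).
  have : Rle (Rmult y y) (Rmult (Rmult 4 y) (INR h)).
    rewrite -ey; apply: Rle_trans le _; apply: Rmult_le_compat_r => //; Lra.lra.
  by move=> le2; apply: (Rmult_le_reg_l (Rmult 4 y)); [|move: le2]; Lra.lra.
have e4 : pow2 (Rminus (Rdiv (INR n) 2) 2) = Rdiv y 4.
  have p4 : Rpower 2 2 = IZR 4.
    have {2}<- : INR 2 = IZR 2 by rewrite /=; Lra.lra.
    by rewrite Rpower_pow /=; Lra.lra.
  by rewrite /pow2 /Rminus Rpower_plus Rpower_Ropp p4.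
rewrite /height_bound e4.
have ln_ge0 : Rle 0 (ln (INR n)) by rewrite -ln_1; apply/Rlt_le/ln_increasing; Lra.lra.
have ln2 : Rlt 0 (ln 2) by rewrite -ln_1; apply: ln_increasing; Lra.lra.
have log_ge0 : Rle 0 (log2 (INR n)).
  by apply: Rmult_le_pos => //; apply/Rlt_le/Rinv_0_lt_compat.
have : Rle 0 (Rdiv (Rplus (Rmult 1 (INR n)) (Rmult 2 (log2 (INR n))))
                   (pow2 (Rplus (Rdiv (INR n) 2) 2))).
  apply: Rmult_le_pos; first by Lra.lra.
  by apply/Rlt_le/Rinv_0_lt_compat/exp_pos.
Lra.lra.
Qed.

(** * Choice of parameters and conclusion *)

Lemma refutation_exponential n (lines : seq (line n)) : (4096 <= n)%N ->
  pcr_refutation lines ->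
  (forall t a b k l, (t < size lines)%N ->
     (nth (0%R, RHyp n) lines t).2 = RLin n a b k l ->
     (`|a| <= (2 ^ (2 ^ uphalf n))%:R :> rat)%R
     /\ (`|b| <= (2 ^ (2 ^ uphalf n))%:R :> rat)%R) ->
  (pcr_num_monomials lines < 2 ^ (n %/ 1024))%N ->
  (2 ^ n <= (2 ^ uphalf n).+1 * pcr_height lines)%N.
Proof.
move=> n_ge ref scalars few.
pose mons := undup (flatten [seq msupp ln.1 | ln <- lines]).
(* With [Q = 32] and [q = n / 4], at most [n / 32] variables per block are frozen and [w] is at most
   [5 * n / 16], so [3 * w] stays below the number of free variables. *)
pose s := (n %/ 1024)%N; pose w := (n %/ 4 + 2 * (32 * s))%N.
pose row i : {set 'I_n * 'I_(2 * n)} := in_block (@fst 'I_n 'I_(2 * n)) i [set: _].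
pose fam i : {set {set 'I_n * 'I_(2 * n) * bool}} :=
  [set L | (L \in [seq mon_lits m | m <- mons]) && (w <= #|L :&: lits (row i)|)%N].
have [|i|i|i L|A [F [fixed_few hit]]] :=
  @block_restriction _ _ (@fst 'I_n 'I_(2 * n)) fam (n %/ 4) 32 s.
- by lia.
- by rewrite card_row; lia.
- apply: leq_ltn_trans few.
  rewrite -[pcr_num_monomials _]/(size mons) -(size_map (@mon_lits n)).
  apply: leq_trans (card_size _); apply: subset_leq_card.
  by apply/subsetP => L; rewrite inE => /andP[].
- by rewrite inE => /andP[].
have room i : (3 * w < #|in_block (@fst 'I_n 'I_(2 * n)) i A|)%N.
  have := card_row i; rewrite -(cardsID A).
  have -> : in_block fst i [set: 'I_n * 'I_(2 * n)] :&: A = in_block fst i A.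
    by apply/setP => v; rewrite !inE andbC.
  have -> : in_block fst i [set: 'I_n * 'I_(2 * n)] :\: A = in_block fst i (~: A).
    by apply/setP => v; rewrite !inE.
  have := fixed_few i; rewrite /w /s.
  move: #|in_block _ _ (~: A)| #|in_block _ _ A| => a b. lia.
have n_gt0 : (0 < n)%N by lia.
have w_gt0 : (0 < w)%N by rewrite /w; lia.
have killed t m : (t < size lines)%N -> m \in msupp (nth (0%R, RHyp n) lines t).1 ->
    (exists2 l, l \in mon_lits m & (l.1 \notin A) && (F l.1 == l.2))
    \/ (forall i, #|mon_lits m :&: lits (row i)| <= w)%N.
  move=> t_lt m_in.
  have m_mons : m \in mons.
    rewrite mem_undup; apply/flattenP; exists (msupp (nth (0%R, RHyp n) lines t).1) => //.
    by rewrite -(nth_map _ [::] (fun ln : line n => msupp ln.1)) // mem_nth // size_map.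
  have [/forallP narrow|/forallPn[i]] :=
      boolP [forall i, #|mon_lits m :&: lits (row i)| <= w]%N; first by right.
  rewrite -ltnNge => /ltnW wide; left; apply: (hit i).
  by rewrite inE wide andbT; apply: map_f.
(* Here [C] is twice the scalar bound, a power of 2 with exponent [(2 ^ uphalf n).+1]. *)
have := @height_exponential n lines A F w (2 ^ (2 ^ uphalf n))%:R
  (2 * 2 ^ (2 ^ uphalf n))%:R n_gt0 w_gt0 room ref killed scalars.
rewrite -natrM lexx => /(_ isT).
have -> : (1 + (n%:R + 1 + (3 * #|{: 'I_n * 'I_(2 * n)}|).+1%:R
    + (n%:R + 1 + (3 * #|{: 'I_n * 'I_(2 * n)}|).+1%:R) ^+ 2) <=
    (2 * 2 ^ (2 ^ uphalf n))%:R :> rat)%R.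
  rewrite card_prod !card_ord -(natrD _ n 1) -!natrD -natrX -!natrD -(natrD _ 1) ler_nat.
  by apply: quadratic_count; lia.
move=> /(_ isT); rewrite -!natrX ler_nat -expnS -expnM leq_exp2l //.
Qed.

Theorem theorem10 :
  exists (c d : R), Rlt 0 c /\ Rlt 0 d /\
  exists N : nat, forall n : nat, (N <= n)%N ->
  forall lines : seq (line n),
    pcr_refutation lines ->
    pcr_bounded (pow2 (pow2 (Rdiv (INR n) 2))) lines ->
    Rle (INR (pcr_num_monomials lines)) (pow2 (Rmult d (INR n))) ->
    Rle (height_bound c n) (INR (pcr_height lines)).
Proof.
exists (IZR 1), (Rinv 2048); split; first by Lra.lra.
split; first by Lra.lra.
exists (4 * 1024)%N => n n_ge lines ref bounded few.
(* [n / 2] need not be an integer; rounding it up gives a natural scalar bound. *)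
have bound_le : Rle (pow2 (pow2 (Rdiv (INR n) 2))) (INR (2 ^ (2 ^ uphalf n))).
  by rewrite !INR_expn2; do 2!apply: pow2_le; apply: half_le_uphalf.
apply: height_from_exponential; first by lia.
apply: refutation_exponential => //.
- move=> t a b k l t_lt rt; have [_] := bounded t t_lt; rewrite rt => -[la lb].
  by split; apply: rat2R_norm_le; apply: Rle_trans bound_le.
by apply: monomials_few => //; lia.
Qed.
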